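(* Let $k\ge3$ be an odd integer and let $A$ be a cyclically $k$-diagonal array of odd size $n$ with $n>k$ and $n\ge (k-2)(k-1)$. Then $P(A)$ has a solution.
   Context: Arrays are toroidal: an $n\times n$ array has rows and columns indexed modulo $n$ (representatives $1,\dots,n$). Each cell is filled or empty; $F(A)$ is the set of filled cells. For $(i,j)\in F(A)$: - the row successor $s_r((i,j))$ is $(i,j+k)$ with $k\ge1$ minimal such that $(i,j+k)\in F(A)$; - the column successor $s_c((i,j))$ is $(i+k,j)$ with $k\ge1$ minimal such that $(i+k,j)\in F(A)$. Given $R,C\in\{-1,1\}^n$, the move function is $S_{R,C}((i,j))=s_c^{\,c_{j'}}((i,j'))$, where $(i,j')=s_r^{\,r_i}((i,j))$; exponent $-1$ means inverse. $R,C$ is a solution of $P(A)$ if $S_{R,C}$ is a single cycle on $F(A)$. ''$P(A)$ has a solution'' means such $R,C$ exist. Diagonals: $D_i=\{(i+t-1,t): t=1,\dots,n\}$, with row indices modulo $n$. A square array of size $n>k$ is cyclically $k$-diagonal if its filled cells are exactly the cells of $k$ diagonals that are consecutive modulo $n$, i.e. $D_i,\dots,D_{i+k-1}$ for some $i$. *)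

(* Defs.v *)
From mathcomp Require Import all_boot all_order all_algebra.

Set Implicit Arguments.
Unset Strict Implicit.
Unset Printing Implicit Defensive.

(* Indices are 0-based: the paper's row or column m (1 <= m <= n) is the
   element m - 1 of 'I_n, and ordS is the successor modulo n. *)
Definition shift n (m : nat) (x : 'I_n) : 'I_n := iter m (@ordS n) x.

Definition cell (n : nat) : finType := ('I_n * 'I_n)%type.

(* Only the filled/empty status of a cell matters, so an n x n array is
   represented by its set F(A) of filled cells. *)
Definition array (n : nat) := {set cell n}.

(* For a filled cell c the default ord_max (i.e. k = n) satisfies the condition,
   since going round the whole row returns to c; so the arg min is the least
   k >= 1 as intended. Empty cells are fixed by convention, so that each
   successor function is a permutation of all the cells and finv is its
   inverse on F(A). *)
Definition row_succ n (A : array n) (c : cell n) : cell n :=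
  if c \in A then
    let k := [arg min_(k < ord_max : 'I_n.+1 |
                        (0 < k) && ((c.1, shift k c.2) \in A)) (k : nat)] in
    (c.1, shift k c.2)
  else c.

Definition col_succ n (A : array n) (c : cell n) : cell n :=
  if c \in A then
    let k := [arg min_(k < ord_max : 'I_n.+1 |
                        (0 < k) && ((shift k c.1, c.2) \in A)) (k : nat)] in
    (shift k c.1, c.2)
  else c.

Definition iterz (T : finType) (f : T -> T) (z : int) : T -> T :=
  match z with
  | Posz m => iter m f
  | Negz m => iter m.+1 (finv f)
  end.

Definition sign_vector n (R : 'I_n -> int) : Prop :=
  forall i, R i = 1%R \/ R i = (-1)%R.

Definition move n (A : array n) (R C : 'I_n -> int) (c : cell n) : cell n :=
  let c' := iterz (row_succ A) (R c.1) c in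
  iterz (col_succ A) (C c'.2) c'.

Definition single_cycle_on (T : finType) (f : T -> T) (A : {set T}) : Prop :=
  exists s : seq T, [/\ uniq s, s =i A & fcycle f s].

Definition is_solution n (A : array n) (R C : 'I_n -> int) : Prop :=
  [/\ sign_vector R, sign_vector C & single_cycle_on (move A R C) A].

Definition has_solution n (A : array n) : Prop :=
  exists R C : 'I_n -> int, is_solution A R C.

(* With 0-based indices the paper's D_(i+1) = {(i + t, t)} becomes
   diagonal i; only i modulo n matters. *)
Definition diagonal n (i : nat) : array n :=
  [set ((shift i t, t) : cell n) | t : 'I_n].

Definition cyclically_diagonal n (k : nat) (A : array n) : Prop :=
  k < n /\ exists i : 'I_n, A = \bigcup_(d < k) diagonal n (i + d).

(* Main.v *)
Require Import Defs.
From mathcomp Require Import all_boot all_order all_algebra.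
From mathcomp Require Import zify.

(** Put h = k - 1. Take all rows positive and let E be the set of columns of sign
    -1. Write a filled cell as a pair (e, j), where j is its column and it lies on
    the diagonal -2e modulo k (k is odd, so e ranges over Z/k). The move sends j to
    j' = j + 1 if e <> 0 and to j' = j - h if e = 0, and then increases e by 1
    exactly when j' is in E. Hence from (1, x) with x in E the tour visits the next
    h elements of E in increasing order, reaches e = 0, and then jumps backwards
    by h until it meets E again.

    Let d = gcd(h, n), which is odd. If d = 1, the set E = {0} works, since the
    backward jumps visit every column. Otherwise d >= 3, and with l = h + 1 - d take
    for E the k columns x_i = i h (i <= l) and x_(l+t) = l h + t (0 < t < d); they
    fit in [0, n) because n >= h (h - 1). As |E| = k, going h elements forward in E
    means going one element back. The backward jumps permute E by the cycle
    x_i -> x_(i-1) on 0 <= i <= l and fix the others, which are alone in their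
    classes modulo d. The composite sends x_i to x_(i-2) for 2 <= i <= l + 1, x_1 to
    x_l, x_i to x_(i-1) for i > l + 1, and x_0 to x_h; since l is even, this is a
    single cycle. *)

(** * Tours for an arbitrary set of marked columns *)

(* [Q e j] stands for "the tour from (e, j) reaches a fixed target", so the moves
   appear as backward closure properties of [Q]. *)
Section Dynamics.

Variables (n h : nat) (E : pred nat) (Q : nat -> nat -> Prop).
Hypotheses (n_gt0 : 0 < n) (h_gt0 : 0 < h).
Hypothesis E_mod : forall x y, x = y %[mod n] -> E x = E y.
Hypothesis Q_mod : forall e x y, x = y %[mod n] -> Q e x -> Q e y.
Hypothesis Q_wrap : forall j, Q 0 j -> Q h.+1 j.
Hypothesis Q_forward :
  forall e j, 0 < e <= h -> Q (e + E j.+1) j.+1 -> Q e j.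
Hypothesis Q_back : forall j, Q (E j) j -> Q 0 (j + h).

Lemma forward_to_next e j y : 0 < e <= h -> j < y ->
  (forall z, j < z < y -> ~~ E z) -> E y -> Q e.+1 y -> Q e j.
Proof.
move=> e_bd ltjy; rewrite -(subnK ltjy); move: (y - j.+1) => m {ltjy}.
elim: m j => [|m IHm] j no_E Ey Qy.
  by apply: Q_forward => //; rewrite add0n in Ey Qy; rewrite Ey addn1.
apply: Q_forward => //; rewrite (negPf (no_E j.+1 _)) ?ltnSn ?ltnS ?leq_addl //.
rewrite addn0; apply: IHm => [z z_bd||].
- by case/andP: z_bd => /ltnW lt_jz lt_zy; rewrite no_E // lt_jz addSnnS.
- by rewrite -addSnnS.
- by rewrite -addSnnS.
Qed.

(** Adding [h * n.-1] stands for a jump back by [h] modulo [n], which keeps columns in the natural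
    numbers. *)
Lemma back_mod m j : j + m * (h * n.-1) + m * h = j %[mod n].
Proof.
have -> : j + m * (h * n.-1) + m * h = m * h * n + j.
  by rewrite -{2}(prednK n_gt0); lia.
by rewrite modnMDl.
Qed.

Lemma exists_hit j x : x = j %[mod gcdn h n] ->
  exists t, x = j + t.+1 * (h * n.-1) %[mod n].
Proof.
move=> eq_xj; have [km kn def_d _] := egcdnP n h_gt0.
set d := gcdn h n in eq_xj def_d.
have d_dvd_n : d %| n by apply: dvdn_gcdr.
have le_x : x <= j + x * n by rewrite (leq_trans _ (leq_addl _ _)) ?leq_pmulr.
have /dvdnP[q def_q] : d %| j + x * n - x.
  rewrite -eqn_mod_dvd // eq_xj; apply/eqP.
  by rewrite -modnDmr -modnMmr (eqP d_dvd_n) muln0 mod0n addn0.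
have {}def_q : q * d + x = j + x * n by rewrite -def_q subnK.
(* By Bezout [q * km] jumps back lead from [j] to [x]; [n] further jumps change nothing modulo [n]
   and make the count positive. *)
have [s def_s] : exists s, q * km + n = s.+1 by exists (q * km + n).-1; lia.
exists s; apply/eqP; rewrite -(eqn_modDr (s.+1 * h)) back_mod -def_s.
have -> : x + (q * km + n) * h = (q * kn + h + x) * n + j.
  have : q * (km * h) = q * (kn * n + d) by rewrite def_d.
  by lia.
by rewrite modnMDl.
Qed.

(** The jumps sweep the class of [j] modulo the gcd, so they meet a marked column. The last
    condition singles out the first hit: the column just before it was unmarked or was the start.
    Induction on the distance to some known hit. *)
Lemma back_to_hit j :
  (exists2 x, E x & x = j %[mod gcdn h n]) ->
  (forall x, E x -> x = j %[mod gcdn h n] ->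
     ~~ E (x + h) \/ x + h = j %[mod n] -> Q 1 x) ->
  Q 0 j.
Proof.
case=> x0 Ex0 /exists_hit[t def_x0]; rewrite (E_mod _ _ def_x0) in Ex0.
have jh i : i + 1 * (h * n.-1) + h = i %[mod n].
  by have := back_mod 1 i; rewrite [1 * h]mul1n.
have jd i : i + 1 * (h * n.-1) = i %[mod gcdn h n].
  by rewrite -modnDmr mul1n -modnMml (eqP (dvdn_gcdl h n)) mod0n addn0.
elim: t j Ex0 {x0 def_x0} => [|t IHt] j Et hit; apply: Q_mod (jh j) _.
  by apply: Q_back; rewrite Et; apply: hit ; [|exact: jd|right; exact: jh].
apply: Q_back; set j1 := j + 1 * (h * n.-1).
case Ej1: (E j1); first by apply: hit; [|exact: jd|right; exact: jh].
apply: IHt => [|x Ex eq_x far].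
  by rewrite /j1 -addnA -mulnDl add1n.
apply: hit => //; first by rewrite eq_x jd.
by left; case: far => // /E_mod ->; rewrite Ej1.
Qed.

(** Each forward run to the next marked column raises [e] by one, so induction on [h.+1 - e] leads
    to the wrap from [h.+1] to 0, where the backward jumps take over. *)
Lemma all_from_hits :
  (forall j, exists2 x, E x & x = j %[mod gcdn h n]) ->
  (forall x, E x -> Q 1 x) -> forall e j, e <= h -> Q e j.
Proof.
move=> cover Q1; have Q0 j : Q 0 j.
  by apply: back_to_hit => // x Ex _ _; apply: Q1.
suff Qtop m j : m <= h -> Q (h.+1 - m) j.
  move=> [|e] j le_e //; have := Qtop (h - e) j (leq_subr _ _).
  by have -> : h.+1 - (h - e) = e.+1 by lia.
elim: m j => [|m IHm] j le_m; first by rewrite subn0; apply: Q_wrap.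
have exE : exists y, (j < y) && E y.
  have [x Ex _] := cover 0; exists (x + j.+1 * n).
  rewrite (E_mod _ x) ?Ex ?andbT; last by rewrite addnC modnMDl.
  by rewrite (leq_trans _ (leq_addl _ _)) ?leq_pmulr.
case: (ex_minnP exE) => y /andP[ltjy Ey] y_min.
apply: (@forward_to_next _ _ y) => //; first by lia.
  move=> z /andP[jz zy]; apply/negP => Ez.
  by have := y_min z; rewrite jz Ez leqNgt zy => /(_ isT).
by rewrite subSS -subSn ?(ltnW le_m) //; apply: IHm; apply: ltnW.
Qed.

End Dynamics.

(** * The marked columns and the cycle they produce *)

Definition marked n h j :=
  let d := gcdn h n in let L := (h.+1 - d) * h in let r := j %% n in
  if d == 1 then r == 0 else (h %| r) && (r <= L) || (L <= r < L + d).

Lemma marked_mod n h x y : x = y %[mod n] -> marked n h x = marked n h y.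
Proof. by rewrite /marked => ->. Qed.

Section Marked.

Variables (n h : nat).
Hypotheses (n_odd : odd n) (h_even : ~~ odd h) (h_gt0 : 0 < h).
Hypothesis n_large : h.-1 * h <= n.

Let d := gcdn h n.
Let l := h.+1 - d.
Let L := l * h.
Let E := marked n h.
Let x i := if i <= l then i * h else L + (i - l).

Hypothesis d_neq1 : d != 1.

Let n_gt0 : 0 < n. Proof. by case: n n_odd. Qed.
Let d_dvd_h : d %| h. Proof. exact: dvdn_gcdl. Qed.
Let d_odd : odd d.
Proof. exact: dvdn_odd (dvdn_gcdr h n) n_odd. Qed.
Let d_ge3 : 2 < d.
Proof. by move: d_neq1 d_odd; case: (d) => [|[|[|m]]]. Qed.
(** As [h] is even and [d] odd, the quotient h / d is even, hence at least 2. *)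
Let d2_le_h : d.*2 <= h.
Proof.
case/dvdnP: d_dvd_h => q def_h; rewrite def_h.
have q_even : ~~ odd q.
  by move: h_even; rewrite def_h oddM d_odd andbT.
have q_gt1 : 1 < q.
  by case: q def_h q_even => [|[|q]] //; move: h_gt0 => /[swap] ->.
by rewrite -mul2n leq_pmul2r // (leq_trans _ d_ge3).
Qed.
(** The bound [n_large] enters here: [L] falls short of [h.-1 * h] by (d - 2) h, which is at least
    [d]. *)
Let Ld_le_n : L + d <= n.
Proof.
suff : L + d <= h.-1 * h by move/leq_trans; apply.
rewrite /L /l; have [m def_d] : exists m, d = m.+3 by exists (d - 3); lia.
have le_h : m.+3 <= h by lia.
have -> : h.-1 = h.+1 - d + m.+1 by lia.
by rewrite mulnDl leq_add2l def_d mulSn; lia.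
Qed.
Let L_eq : L = l * h. Proof. by []. Qed.
Let l_eq : l + d = h.+1. Proof. rewrite /l; lia. Qed.

Let lt_lh : l.+1 < h. Proof. by lia. Qed.

Let markedE y : y < n -> E y = (h %| y) && (y <= L) || (L <= y < L + d).
Proof. by move=> lt_yn; rewrite /E /marked modn_small // -/d (negPf d_neq1). Qed.

Let x_lt i : i <= h -> x i < n.
Proof.
rewrite /x; case: (leqP i l) => [le_il _|]; last by lia.
have : i * h <= L by rewrite leq_mul2r le_il orbT.
by lia.
Qed.

Let x_marked i : i <= h -> E (x i).
Proof.
move=> le_ih; rewrite markedE ?x_lt // /x; case: (leqP i l) => [le_il|lt_li].
  by rewrite dvdn_mull //= leq_mul2r le_il orbT.
by apply/orP; right; lia.
Qed.

Let marked_x y : y < n -> E y -> exists2 i, i <= h & y = x i.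
Proof.
move=> lt_yn; rewrite markedE // => /orP[/andP[/dvdnP[q ->]]|/andP[leLy ltyL]].
  rewrite /L leq_pmul2r // => le_ql; exists q; first by lia.
  by rewrite /x le_ql.
exists (y - L + l); first by lia.
rewrite /x; case: (leqP _ l) => ?; last by lia.
have -> : y = L by lia.
by rewrite /L subnn add0n.
Qed.

Let x_lt_mono i : i < h -> x i < x i.+1.
Proof.
rewrite /x => lt_ih; case: (ltngtP i l) => [lt_il|lt_li|eq_il].
- by rewrite ltn_pmul2r.
- by lia.
- by rewrite eq_il -/L; lia.
Qed.

Let x_gap i z : i < h -> x i < z < x i.+1 -> ~~ E z.
Proof.
move=> lt_ih /andP[ltxz ltzx]; have := x_lt i.+1 lt_ih => lt_xn.
rewrite markedE; last by lia.
move: ltxz ltzx; rewrite /x; case: (ltngtP i l) => [lt_il|lt_li|eq_il] ? ?.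
- have lt_zL : z < L by apply: leq_trans (_ : i.+1 * h <= L); rewrite ?leq_mul2r ?lt_il ?orbT.
  rewrite [_ <= z]leqNgt lt_zL orbF; apply/negP => /andP[/dvdnP[q def_z] _].
  have : i < q by rewrite -(ltn_pmul2r h_gt0) -def_z.
  have : q < i.+1 by rewrite -(ltn_pmul2r h_gt0) -def_z.
  lia.
- by lia.
- by move: (eq_il); rewrite /L; lia.
Qed.

Let x_gap_last z : x h < z < n -> ~~ E z.
Proof.
rewrite /x; case: (leqP h l) => [?|_ z_bd]; first by lia.
by rewrite markedE; lia.
Qed.

(** The [d] consecutive marked columns from [L] on form a complete residue system modulo [d]. *)
Lemma marked_cover j : exists2 y, E y & y = j %[mod d].
Proof.
exists (L + j %% d); last by rewrite /L -modnDml -modnMmr (eqP d_dvd_h) muln0 mod0n add0n modn_mod.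
have ltjd : j %% d < d by rewrite ltn_mod; lia.
rewrite markedE; last by lia.
by apply/orP; right; lia.
Qed.

Let x_mod i : i <= h -> x i %% d = if i <= l then 0 else i - l.
Proof.
rewrite /x; case: (leqP i l) => [_|lt_li] le_ih.
  by rewrite -modnMmr (eqP d_dvd_h) muln0 mod0n.
by rewrite /L -modnDml -modnMmr (eqP d_dvd_h) muln0 mod0n add0n modn_small //; lia.
Qed.

Variable Q : nat -> nat -> Prop.
Hypothesis Q_mod : forall e x y, x = y %[mod n] -> Q e x -> Q e y.
Hypothesis Q_wrap : forall j, Q 0 j -> Q h.+1 j.
Hypothesis Q_forward :
  forall e j, 0 < e <= h -> Q (e + E j.+1) j.+1 -> Q e j.
Hypothesis Q_back : forall j, Q (E j) j -> Q 0 (j + h).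

Let hop m e i : 0 < e -> e + m <= h.+1 -> i + m <= h ->
  Q (e + m) (x (i + m)) -> Q e (x i).
Proof.
elim: m e i => [|m IHm] e i e_gt0 le_em le_im; first by rewrite !addn0.
rewrite -!addSnnS => Qm.
apply: (forward_to_next _ _ _ Q_forward _ _ (x i.+1)).
- by lia.
- by apply: x_lt_mono; lia.
- by move=> z; apply: x_gap; lia.
- by apply: x_marked; lia.
- by apply: IHm => //; lia.
Qed.

Let hop_last e : 0 < e <= h -> Q e.+1 (x 0) -> Q e (x h).
Proof.
move=> e_bd Q0; apply: (forward_to_next _ _ _ Q_forward _ _ n) => //.
- exact: x_lt.
- by rewrite /E (marked_mod _ _ n 0) ?modnn ?mod0n //; apply: (x_marked 0).
- by apply: Q_mod Q0; rewrite /x modnn mul0n mod0n.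
Qed.

(** There are h + 1 marked columns, so [h] hops forward lead one back: h - i - 1 hops to [x h], one
    across column [n] to [x 0], and [i] more to [x i], where [e] has become h + 1. *)
Let round i : i < h -> Q 0 (x i) -> Q 1 (x i.+1).
Proof.
move=> lt_ih Qi; apply: (hop (h - i.+1)) => //; try lia.
rewrite subnKC //; apply: hop_last; first by lia.
apply: (hop i) => //; try lia.
rewrite add0n; have -> : (1 + (h - i.+1)).+1 + i = h.+1 by lia.
exact: Q_wrap.
Qed.

Let back_step i : i < l -> Q 1 (x i) -> Q 0 (x i.+1).
Proof.
move=> lt_il Qi; have -> : x i.+1 = x i + h.
  by rewrite /x lt_il (ltnW lt_il) mulSn addnC.
by apply: Q_back; rewrite x_marked //; lia.
Qed.

(** A first hit lies in class 0, so it is some [x i] with i <= l. If i < l, the jump before it was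
    at [x i.+1], which is marked and differs from the start [x 0]. *)
Let back_zero : Q 1 (x l) -> Q 0 (x 0).
Proof.
move=> Ql; apply: (back_to_hit n h E) => //; first exact: marked_mod.
  exact: marked_cover.
move=> y Ey; have lt_yn : y %% n < n by rewrite ltn_mod.
have Eyn : E (y %% n) by rewrite /E (marked_mod _ _ _ y) ?modn_mod.
have [i le_ih def_y] := marked_x _ lt_yn Eyn.
have eq_y : y = x i %[mod n] by rewrite -def_y modn_mod.
rewrite -/d x_mod //= => y_d far.
have : x i %% d = 0.
  by rewrite -def_y modn_dvdm // dvdn_gcdr.
rewrite x_mod //; case: (leqP i l) => [le_il _|lt_li /eqP]; last by rewrite subn_eq0 leqNgt lt_li.
have [eq_il|neq_il] := eqVneq i l.
  by apply: Q_mod Ql; rewrite -eq_il.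
have lt_il : i < l by rewrite ltn_neqAle neq_il.
have xS : x i + h = x i.+1.
  by rewrite /x lt_il (ltnW lt_il) mulSn addnC.
have yh : y + h = x i.+1 %[mod n].
  by rewrite -modnDml eq_y modnDml xS.
have lt_ih : i < h := ltn_trans lt_il (ltnW lt_lh).
case: far; first by rewrite (marked_mod _ _ _ _ yh : E _ = E _) x_marked.
rewrite yh !modn_small ?x_lt // => eq_x0.
by have := x_lt_mono i lt_ih; rewrite eq_x0 /x leq0n mul0n.
Qed.

(** For i > l the column [x i] is the only marked one in its class modulo [d], so the jumps return
    to it. *)
Let back_single i : l < i <= h -> Q 1 (x i) -> Q 0 (x i).
Proof.
case/andP=> lt_li le_ih Qi; apply: (back_to_hit n h E) => //; first exact: marked_mod.
  exact: marked_cover.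
move=> y Ey; have lt_yn : y %% n < n by rewrite ltn_mod.
have Eyn : E (y %% n) by rewrite /E (marked_mod _ _ _ y) ?modn_mod.
have [i' le_ih' def_y] := marked_x _ lt_yn Eyn.
rewrite -/d -[y %% d](modn_dvdm y (dvdn_gcdr h n)) -/d def_y !x_mod //.
move=> eq_ii _; suff eq_i : i = i' by apply: Q_mod Qi; rewrite eq_i -def_y modn_mod.
move: eq_ii; rewrite [i <= l]leqNgt lt_li /=; case: (leqP i' l) => [_ eq0|lt_li'].
  by move: lt_li; rewrite -subn_gt0 -eq0.
by move/eqP; rewrite eqn_sub2rE ?(ltnW lt_li) ?(ltnW lt_li') // => /eqP.
Qed.

Lemma marked_reach : Q 1 0 -> forall e j, e <= h -> Q e j.
Proof.
move=> Q10; have M0 : Q 1 (x 0) by [].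
(* The cycle is followed against the tour: even indices from 0 to l, then 1 and the odd indices up
   to l + 1, then one by one up to h. *)
have up i : i < l -> Q 1 (x i) -> Q 1 (x i.+2).
  by move=> lt_il Qi; apply: round; [lia | apply: back_step].
have ups m b : b + m.*2 <= l.+1 -> Q 1 (x b) -> Q 1 (x (b + m.*2)).
  elim: m => [|m IHm] le_m Qb; first by rewrite addn0.
  by rewrite doubleS !addnS; apply: up; [lia | apply: IHm => //; lia].
have l_even : l = l./2.*2.
  have l_even : odd l = false by lia.
  by have := odd_double_half l; rewrite l_even.
have Ml : Q 1 (x l) by rewrite l_even; apply: (ups _ 0) => //; lia.
have M1 : Q 1 (x 1) by apply: round => //; apply: back_zero.
have low i : i <= l.+1 -> Q 1 (x i).
  by move=> le_i; rewrite -(odd_double_half i); case: (odd i); apply: ups => //; lia.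
have all_x m : l.+1 + m <= h -> Q 1 (x (l.+1 + m)).
  elim: m => [|m IHm] le_m; first by rewrite addn0; apply: low.
  by rewrite addnS; apply: round; [lia | apply: back_single; [lia | apply: IHm; lia]].
apply: (all_from_hits n h E) => //; first exact: marked_mod.
  exact: marked_cover.
move=> y Ey; have lt_yn : y %% n < n by rewrite ltn_mod.
have Eyn : E (y %% n) by rewrite /E (marked_mod _ _ _ y) ?modn_mod.
have [i le_ih def_y] := marked_x _ lt_yn Eyn.
apply: (Q_mod _ (x i)); first by rewrite -def_y modn_mod.
have [le_i|lt_i] := leqP i l.+1; first exact: low.
by rewrite -(subnKC (ltnW lt_i)); apply: all_x; rewrite subnKC // ltnW.
Qed.

End Marked.

Lemma marked_all_reach n h (Q : nat -> nat -> Prop) :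
  odd n -> ~~ odd h -> 0 < h -> h.-1 * h <= n ->
  (forall e x y, x = y %[mod n] -> Q e x -> Q e y) ->
  (forall j, Q 0 j -> Q h.+1 j) ->
  (forall e j, 0 < e <= h -> Q (e + marked n h j.+1) j.+1 -> Q e j) ->
  (forall j, Q (marked n h j) j -> Q 0 (j + h)) ->
  Q 1 0 -> forall e j, e <= h -> Q e j.
Proof.
move=> n_odd h_even h_gt0 n_large Q_mod Q_wrap Q_fwd Q_back Q10.
have [d1|d_neq1] := eqVneq (gcdn h n) 1; last exact: (@marked_reach n h).
have n_gt0 : 0 < n := odd_gt0 n_odd.
apply: (all_from_hits n h (marked n h)) => //; first exact: marked_mod.
  by move=> j; exists 0; rewrite ?d1 ?modn1 // /marked d1 mod0n.
by move=> x; rewrite /marked d1 => /eqP x0; apply: Q_mod Q10; rewrite x0 mod0n.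
Qed.

(** * Single cycles from reachability, and evaluation of the successor functions *)

Lemma surj_inj (T : finType) (f : T -> T) :
  (forall y, exists x, f x = y) -> injective f.
Proof. by case/fin_all_exists => g gK; apply: can_inj (canF_sym gK). Qed.

(** Injectivity on a finite type makes [fconnect] symmetric, so the orbit of [c0] is all of [A]. *)
Lemma single_cycle_of_reach {T : finType} (f : T -> T) (A : {set T}) c0 :
  injective f -> {homo f : c / c \in A} -> c0 \in A ->
  (forall c, c \in A -> fconnect f c c0) -> single_cycle_on f A.
Proof.
move=> f_inj fA c0A reach; exists (orbit f c0); split.
- exact: orbit_uniq.
- move=> c; rewrite -fconnect_orbit; apply/idP/idP => [|cA].
    by move/iter_findex <-; elim: (findex _ _ _) => //= m; apply: fA.
  by rewrite fconnect_sym //; apply: reach.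
- exact: cycle_orbit.
Qed.

Lemma val_shift n m (x : 'I_n) : shift m x = (x + m) %% n :> nat.
Proof.
elim: m => [|m IHm] /=; first by rewrite addn0 modn_small.
by rewrite IHm -addn1 modnDml addn1 addnS.
Qed.

Lemma arg_min_first n (P : pred nat) m : P n -> 0 < m <= n -> P m ->
  (forall m', 0 < m' < m -> ~~ P m') ->
  [arg min_(k < ord_max : 'I_n.+1 | (0 < k) && P k) (k : nat)] = m :> nat.
Proof.
move=> Pn /andP[m_gt0 le_mn] Pm m_min.
case: arg_minnP => /= [|k /andP[k_gt0 Pk] k_min].
  by rewrite Pn (leq_trans m_gt0 le_mn).
apply/eqP; rewrite eqn_leq; apply/andP; split.
  have lt_mn : m < n.+1 by [].
  by apply: (k_min (Ordinal lt_mn)); rewrite /= m_gt0.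
rewrite leqNgt; apply/negP => lt_km.
by have := m_min k; rewrite k_gt0 lt_km Pk => /(_ isT).
Qed.

(** * The move in coordinates (diagonal, column) *)

Section DiagonalCells.

Variables (n h i0 : nat).
Hypotheses (n_gt0 : 0 < n) (h_gt0 : 0 < h) (lt_hn : h.+1 < n).

Let o j : 'I_n := Ordinal (ltn_pmod j n_gt0).

Let A : array n := \bigcup_(d < h.+1) diagonal n (i0 + d).

Definition diag_cell d j : cell n := (o (i0 + d + j), o j).
Local Notation P := diag_cell.

Let o_eq x y : x = y %[mod n] -> o x = o y.
Proof. by move=> eq_xy; apply: val_inj. Qed.

Let o_val (x : 'I_n) : o x = x.
Proof. by apply: val_inj; rewrite /= modn_small. Qed.

Lemma diag_cell_mod d x y : x = y %[mod n] -> P d x = P d y.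
Proof.
by move=> eq_xy; rewrite /P (o_eq _ _ eq_xy) (o_eq _ (i0 + d + y)) // -modnDmr eq_xy modnDmr.
Qed.

Let shift_o m x : shift m (o x) = o (x + m).
Proof. by apply: ord_inj; rewrite val_shift /= modnDml. Qed.

Let shift_n (x : 'I_n) : shift n x = x.
Proof. by apply: ord_inj; rewrite val_shift modnDr modn_small. Qed.

Lemma mem_diag_cells x y :
  reflect (exists2 d, d <= h & x = i0 + d + y %[mod n]) ((o x, o y) \in A).
Proof.
apply: (iffP bigcupP) => [[d _ /imsetP[t _ [def_x def_y]]]|[d le_dh eq_x]].
  exists d; first by rewrite -ltnS.
  by move/(congr1 val): def_x; rewrite -def_y shift_o addnC.
exists (Ordinal (le_dh : d < h.+1)) => //; apply/imsetP; exists (o y) => //.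
by rewrite shift_o; congr (_, _); apply: o_eq; rewrite eq_x addnC.
Qed.

Lemma diag_cell_in d j : d <= h -> P d j \in A.
Proof. by move=> le_dh; apply/mem_diag_cells; exists d. Qed.

Lemma diag_cell_surj c : c \in A -> exists d j, d <= h /\ c = P d j.
Proof.
case: c => a b; rewrite -[a]o_val -[b]o_val => /mem_diag_cells[d le_dh eq_a].
by exists d, b; split=> //; congr (_, _); apply: o_eq.
Qed.

Let row_succE d j m : d <= h -> 0 < m <= n -> (o (i0 + d + j), o (j + m)) \in A ->
  (forall m', 0 < m' < m -> (o (i0 + d + j), o (j + m')) \notin A) ->
  row_succ A (P d j) = (o (i0 + d + j), o (j + m)).
Proof.
move=> le_dh m_bd mA m_min; rewrite /row_succ diag_cell_in //=.
rewrite (@arg_min_first n (fun k => (o (i0 + d + j), shift k (o j)) \in A) m) //=.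
- by rewrite shift_o.
- by rewrite shift_n diag_cell_in.
- by rewrite shift_o.
- by move=> m' m'_bd; rewrite shift_o m_min.
Qed.

Let col_succE d j m : d <= h -> 0 < m <= n -> (o (i0 + d + j + m), o j) \in A ->
  (forall m', 0 < m' < m -> (o (i0 + d + j + m'), o j) \notin A) ->
  col_succ A (P d j) = (o (i0 + d + j + m), o j).
Proof.
move=> le_dh m_bd mA m_min; rewrite /col_succ diag_cell_in //=.
rewrite (@arg_min_first n (fun k => (shift k (o (i0 + d + j)), o j) \in A) m) //=.
- by rewrite shift_o.
- by rewrite shift_n diag_cell_in.
- by rewrite shift_o.
- by move=> m' m'_bd; rewrite shift_o m_min.
Qed.

Lemma row_succ_inner d j : d < h -> row_succ A (P d.+1 j) = P d j.+1.
Proof.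
move=> lt_dh; have eq_cell : (o (i0 + d.+1 + j), o (j + 1)) = P d j.+1.
  by rewrite /P; congr (o _, o _); lia.
rewrite (row_succE _ _ 1) ?eq_cell ?diag_cell_in //; try lia.
Qed.

Lemma row_succ_wrap j : row_succ A (P 0 (j + h)) = P h j.
Proof.
have eq_cell : (o (i0 + 0 + (j + h)), o (j + h + (n - h))) = P h j.
  have -> : j + h + (n - h) = j + n by lia.
  rewrite /P (o_eq (j + n) j) ?modnDr //; congr (o _, _); lia.
rewrite (row_succE _ _ (n - h)) ?eq_cell ?diag_cell_in //; first by lia.
move=> m /andP[m_gt0 lt_m]; apply/mem_diag_cells => -[d le_dh].
have -> : i0 + d + (j + h + m) = i0 + 0 + (j + h) + (d + m) by lia.
(* Here 0 < d + m < n, so the shift is nonzero modulo [n]. *)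
by rewrite -{1}[_ + (j + h)]addn0 => /eqP; rewrite eqn_modDl mod0n modn_small; lia.
Qed.

Lemma col_succ_inner d j : d < h -> col_succ A (P d j) = P d.+1 j.
Proof.
move=> lt_dh; have eq_cell : (o (i0 + d + j + 1), o j) = P d.+1 j.
  by rewrite /P; congr (o _, o _); lia.
rewrite (col_succE _ _ 1) ?eq_cell ?diag_cell_in //; try lia.
Qed.

Lemma col_succ_wrap j : col_succ A (P h j) = P 0 j.
Proof.
have eq_cell : (o (i0 + h + j + (n - h)), o j) = P 0 j.
  have -> : i0 + h + j + (n - h) = i0 + 0 + j + n by lia.
  by rewrite /P (o_eq (_ + n) (i0 + 0 + j)) ?modnDr.
rewrite (col_succE _ _ (n - h)) ?eq_cell ?diag_cell_in //; first by lia.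
move=> m /andP[m_gt0 lt_m]; apply/mem_diag_cells => -[d le_dh].
have -> : i0 + h + j + m = i0 + j + (h + m) by lia.
have -> : i0 + d + j = i0 + j + d by lia.
by move/eqP; rewrite eqn_modDl !modn_small; lia.
Qed.

(** By finiteness surjectivity suffices: filled cells have explicit preimages and empty cells are
    fixed. *)
Lemma row_succ_inj : injective (row_succ A).
Proof.
apply: surj_inj => c; have [cA|cA] := boolP (c \in A); last first.
  by exists c; rewrite /row_succ (negPf cA).
have [d [j [le_dh ->]]] := diag_cell_surj c cA.
have [lt_dh|] := ltnP d h.
  exists (P d.+1 (j + n.-1)); rewrite row_succ_inner //.
  by apply: diag_cell_mod; rewrite -addnS prednK // modnDr.
by exists (P 0 (j + h)); rewrite row_succ_wrap; congr P; lia.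
Qed.

Lemma col_succ_inj : injective (col_succ A).
Proof.
apply: surj_inj => c; have [cA|cA] := boolP (c \in A); last first.
  by exists c; rewrite /col_succ (negPf cA).
have [[|d] [j [le_dh ->]]] := diag_cell_surj c cA.
  by exists (P h j); apply: col_succ_wrap.
by exists (P d j); apply: col_succ_inner.
Qed.

Lemma finv_col_inner d j : d < h -> finv (col_succ A) (P d.+1 j) = P d j.
Proof. by move=> lt_dh; rewrite -col_succ_inner // finv_f //; apply: col_succ_inj. Qed.

Lemma finv_col_wrap j : finv (col_succ A) (P 0 j) = P h j.
Proof. by rewrite -col_succ_wrap finv_f //; apply: col_succ_inj. Qed.

Let col_succ_col c : (col_succ A c).2 = c.2.
Proof. by rewrite /col_succ; case: ifP. Qed.

Let iterz_col_col z c : (iterz (col_succ A) z c).2 = c.2.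
Proof.
have iter_col m c' : (iter m (col_succ A) c').2 = c'.2.
  by elim: m => //= m IHm; rewrite col_succ_col.
by case: z => m /=; [| elim: m => [|m IHm] /=; rewrite /finv]; rewrite iter_col.
Qed.

(** Column steps preserve the column, so cells with equal images used the same exponent, and that
    power of [col_succ] can be cancelled. *)
Lemma move_inj (C : 'I_n -> int) : injective (move A (fun=> 1%R) C).
Proof.
move=> c c'; rewrite /move /= => eq_m; apply: row_succ_inj.
have := congr1 snd eq_m; rewrite !iterz_col_col => eq_col.
move: eq_m; rewrite eq_col; case: (C _) => m; rewrite /iterz.
  by elim: m => //= m IHm /col_succ_inj.
by elim: m.+1 => //= p IHp /(finv_inj col_succ_inj).
Qed.

Variable E : pred nat.
Hypothesis E_mod : forall x y, x = y %[mod n] -> E x = E y.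

Let C (j : 'I_n) : int := if E j then (-1)%R else 1%R.
Let f := move A (fun=> 1%R) C.

Let C_o j : C (o j) = if E j then (-1)%R else 1%R.
Proof. by rewrite /C (E_mod _ j) //= modn_mod. Qed.

Lemma move_zero j : f (P 0 (j + h)) = P (if E j then h.-1 else 0) j.
Proof.
rewrite /f /move /= row_succ_wrap C_o; case: (E j) => /=.
  by rewrite -{1}(prednK h_gt0) finv_col_inner // prednK.
exact: col_succ_wrap.
Qed.

(** The row step lowers the diagonal by one; the column step restores it or lowers it once more.
    Adding [h.-1] is subtracting 2 modulo [h.+1]. *)
Lemma move_pos d j : d < h ->
  f (P d.+1 j) = P (if E j.+1 then (d.+1 + h.-1) %% h.+1 else d.+1) j.+1.
Proof.
move=> lt_dh; rewrite /f /move /= row_succ_inner // C_o; case: (E j.+1) => /=.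
  case: d lt_dh => [_|d lt_dh].
    by rewrite finv_col_wrap add1n prednK // modn_small.
  rewrite finv_col_inner; last by lia.
  have -> : d.+2 + h.-1 = d + h.+1 by lia.
  by rewrite modnDr modn_small //; lia.
exact: col_succ_inner.
Qed.

Lemma move_in c : c \in A -> f c \in A.
Proof.
move=> /diag_cell_surj[[|d] [j [le_dh ->]]].
  have -> : P 0 j = P 0 (j + n - h + h).
    by apply: diag_cell_mod; rewrite subnK ?modnDr //; lia.
  by rewrite move_zero diag_cell_in //; case: ifP; lia.
rewrite move_pos // diag_cell_in //; case: ifP => // _.
by rewrite -ltnS ltn_mod.
Qed.

End DiagonalCells.

Theorem theorem4p14 (n k : nat) (A : array n)
    (k_ge3 : 3 <= k) (k_odd : odd k) (n_odd : odd n)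
    (k_lt_n : k < n) (n_large : (k - 2) * (k - 1) <= n)
    (A_diag : cyclically_diagonal k A) :
  has_solution A.
Proof.
case: A_diag => _ [i0 -> {A}]; case: k k_ge3 k_odd k_lt_n n_large => // h.
rewrite ltnS => h_gt1 /= h_even lt_hn n_large.
have n_gt0 : 0 < n := odd_gt0 n_odd.
have h_gt0 : 0 < h by apply: ltnW.
have {}n_large : h.-1 * h <= n.
  by move: n_large; have [-> ->] : h.+1 - 2 = h.-1 /\ h.+1 - 1 = h by lia.
pose C (j : 'I_n) : int := if marked n h j then (-1)%R else 1%R.
exists (fun=> 1%R), C; split; first by left.
  by move=> j; rewrite /C; case: ifP; [right | left].
set A := \bigcup_(d < _) _; set f := move A _ C.
have E_mod := marked_mod n h.
(* This is -2e modulo k = h + 1, with [h.-1] standing for -2. *)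
pose dg e := (h.-1 * e) %% h.+1.
pose st e j := diag_cell n i0 n_gt0 (dg e) j.
have dg_le e : dg e <= h by rewrite -ltnS ltn_mod.
have dgS e : dg e.+1 = (dg e + h.-1) %% h.+1 by rewrite /dg mulnSr modnDml.
have dg_pos e : 0 < e <= h -> 0 < dg e.
  case/andP=> e_gt0 le_eh; rewrite lt0n; apply/negP => dvd_e.
  (* Adding 2e to (h - 1) e gives a multiple of h + 1, and h + 1 is odd. *)
  have : h.+1 %| e * 2.
    by rewrite -(dvdn_addr _ dvd_e); rewrite mulnC -mulnDr addn2 prednK // dvdn_mull.
  rewrite Gauss_dvdl ?coprimen2 //= => /(dvdn_leq e_gt0).
  by rewrite ltnNge le_eh.
have reach e j : e <= h -> fconnect f (st e j) (st 1 0).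
  move: e j; apply: (@marked_all_reach n h) => // [e x y eq_xy|j|e j e_bd|j].
  - by rewrite /st (diag_cell_mod _ _ _ _ _ _ eq_xy).
  - by rewrite /st /dg modnMl muln0 mod0n.
  - apply: connect_trans; apply: connect1; apply/eqP.
    have := dg_pos e e_bd; rewrite /st; case def_d: (dg e) => [|d] // _.
    have lt_dh : d < h by rewrite -def_d dg_le.
    rewrite /f (@move_pos n h) // -def_d.
    by case: (marked n h j.+1); rewrite ?addn1 ?addn0 ?dgS.
  - apply: connect_trans; apply: connect1; apply/eqP.
    have dg0 : dg 0 = 0 by rewrite /dg muln0 mod0n.
    rewrite /st dg0 /f (@move_zero n h) //.
    case: (marked n h j); rewrite ?dg0 // dgS dg0 add0n modn_small //; lia.
apply: (single_cycle_of_reach _ _ (st 1 0)).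
- exact: move_inj.
- by move=> c; apply: move_in.
- exact: diag_cell_in.
move=> c /(diag_cell_surj _ _ _ n_gt0)[d [j [le_dh ->]]].
suff [e le_eh <-] : exists2 e, e <= h & dg e = d by apply: reach.
(* [h./2] inverts -2 modulo h + 1, because -2 (h / 2) = -h = 1. *)
exists ((h./2 * d) %% h.+1); first by rewrite -ltnS ltn_mod.
rewrite /dg modnMmr; have def_h := odd_double_half h.
rewrite (negPf h_even) add0n in def_h; rewrite -[RHS](@modn_small d h.+1) //.
move: def_h h_gt1; case: (h./2) => [<- //|m def_h _]; rewrite -def_h.
have -> : (m.+1.*2).-1 * (m.+1 * d) = m * d * (m.+1.*2).+1 + d.
  by rewrite doubleS /= -muln2; lia.
by rewrite modnMDl.
Qed.
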